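(* If $(\mathbb A,\leq)$ and $(\mathbb B,\preceq)$ are non-trivial countable atomless Boolean algebras, then $(\mathbb A,\leq)$ and $(\mathbb B,\preceq)$ are isomorphic as Boolean algebras.
   Context: A Boolean algebra is regarded as a partially ordered set that is a complemented distributive lattice with minimum $0$ and maximum $1$; it is non-trivial if $0\neq 1$. An atom of a Boolean algebra $A$ is a minimal element of $A^+:=A\setminus\{0\}$ with respect to the order of $A$. $A$ is atomless if it has no atoms. A set is countable if it has at most as many elements as $\mathbb N$ (finite sets are allowed). *)

(* Defs.v *)
From mathcomp Require Import all_boot all_order.
From mathcomp Require Import classical_sets cardinality.

Set Implicit Arguments.
Unset Strict Implicit.
Unset Printing Implicit Defensive.

Import Order.Theory.
Local Open Scope order_scope.

(* Boolean algebras are rendered by [ctbDistrLatticeType], the complemented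
   distributive lattices with bottom and top; [\bot = \top] is allowed there. *)

Definition nontrivial (d : Order.disp_t) (A : ctbDistrLatticeType d) : Prop :=
  \bot <> \top :> A.

Definition atom (d : Order.disp_t) (A : ctbDistrLatticeType d) (a : A) : Prop :=
  a <> \bot /\ forall x : A, x <> \bot -> x <= a -> x = a.

Definition atomless (d : Order.disp_t) (A : ctbDistrLatticeType d) : Prop :=
  ~ exists a : A, atom a.

(* Spelled out because [{tblmorphism A -> B}], as declared in [order.v],
   requires only preservation of [\bot] and [\top]. *)
Definition ba_isomorphism (dA dB : Order.disp_t)
    (A : ctbDistrLatticeType dA) (B : ctbDistrLatticeType dB)
    (f : A -> B) : Prop :=
  bijective f /\
  [/\ {mono f : x y / x <= y},
      {morph f : x y / x `&` y},
      {morph f : x y / x `|` y} &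
      {morph f : x / ~` x}] /\
  f \bot = \bot /\ f \top = \top.

Definition ba_isomorphic (dA dB : Order.disp_t)
    (A : ctbDistrLatticeType dA) (B : ctbDistrLatticeType dB) : Prop :=
  exists f : A -> B, ba_isomorphism f.

(* Main.v *)
Require Import Defs.
From mathcomp Require Import all_boot all_order.
From mathcomp Require Import boolp classical_sets cardinality.

(** The proof is Cantor's back-and-forth argument.  A finite list of pairs
    [(a_i, b_i)] is regarded as a finite piece of the future isomorphism; it is
    admissible when every signed meet of the [a_i] vanishes exactly when the
    corresponding signed meet of the [b_i] does, i.e. when
    [a_i |-> b_i] extends to an isomorphism between the generated finite
    subalgebras.  This is [agree \top \top].

    An admissible list can absorb any new [a] ([agree_forth]): inside each
    nonzero cell [p] of the left subalgebra, [a] cuts out nothing, everything,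
    or a proper part, and the corresponding cell [q] on the right can be cut in
    the same way, the last case being possible because [q] is not an atom
    ([split_cell]); gluing the cuts over all cells gives the image of [a].  By
    symmetry it can absorb any new [b] ([agree_back]).

    Alternating the two moves along enumerations of [A] and [B] exhausts both
    algebras ([back_and_forth]).  Any two pairs produced lie in a common
    admissible list, so the resulting correspondence preserves and reflects the
    order ([agree_le]); hence it is an order isomorphism, and the Boolean
    operations, being determined by the order, are preserved as well
    ([order_iso_ba_isomorphism]). *)

Set Implicit Arguments.
Unset Strict Implicit.
Unset Printing Implicit Defensive.

Import Order.Theory.
Local Open Scope order_scope.

(** * Boolean operations are determined by the order *)

Section OrderIso.
Context {dA dB : Order.disp_t}.
Context {A : ctbDistrLatticeType dA} {B : ctbDistrLatticeType dB}.

(** Each of [\bot], [\top], meet and join is characterised by a universal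
    property in the order, and the complement by its meet and join with the
    element. *)
Lemma order_iso_ba_isomorphism (f : A -> B) :
  bijective f -> {mono f : x y / x <= y} -> ba_isomorphism f.
Proof.
move=> bij_f fle; have [g fK gK] := bij_f.
have f0 : f \bot = \bot by apply/eqP; rewrite -lex0 -[leRHS]gK fle le0x.
have f1 : f \top = \top by apply/eqP; rewrite -le1x -[leLHS]gK fle lex1.
have fI : {morph f : x y / x `&` y}.
  move=> x y; apply/le_anti; rewrite lexI !fle leIl leIr /=.
  by rewrite -[f x `&` f y]gK fle lexI -!fle gK leIl leIr.
have fU : {morph f : x y / x `|` y}.
  move=> x y; apply/le_anti; rewrite leUx !fle leUl leUr !andbT.
  by rewrite -[f x `|` f y]gK fle leUx -!fle gK leUl leUr.
split=> //; split=> //; split=> // x; apply/le_anti/andP; split.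
- by rewrite -disj_leC -fI meetC meetxC f0.
- rewrite -[~` f x]meetx1 -f1 -(joinxC x) fU meetUr.
  by rewrite [~` f x `&` f x]meetC meetxC join0x leIr.
Qed.

End OrderIso.

(** * Finite partial isomorphisms *)

Section Agree.
Context {dA dB : Order.disp_t}.
Context {A : ctbDistrLatticeType dA} {B : ctbDistrLatticeType dB}.
Implicit Types (p a : A) (q b : B) (s : seq (A * B)).

(** The signed meets of a list form the leaves of a binary tree; the recursion
    descends this tree, with [p] and [q] the meets chosen so far.  Letting the
    starting cell vary is what makes the inductions below go through. *)
Fixpoint agree p q s : bool :=
  if s is (a, b) :: s' then
    agree (p `&` a) (q `&` b) s' && agree (p `&` ~` a) (q `&` ~` b) s'
  else (p == \bot) == (q == \bot).

Lemma meet_split_eq0 (d : Order.disp_t) (T : ctbDistrLatticeType d) (x y : T) :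
  (x == \bot) = (x `&` y == \bot) && (x `&` ~` y == \bot).
Proof. by rewrite -[x in LHS]meetx1 -(joinxC y) meetUr join_eq0. Qed.

Lemma agree_eq0 p q s : agree p q s -> (p == \bot) = (q == \bot).
Proof.
elim: s p q => [|[a b] s IHs] p q /=; first by move/eqP.
by case/andP=> /IHs h1 /IHs h2; rewrite (meet_split_eq0 p a) h1 h2 -meet_split_eq0.
Qed.

Lemma agree_bot s : agree \bot \bot s.
Proof. by elim: s => [|[a b] s IHs] /=; rewrite ?eqxx // !meet0x IHs. Qed.

(** Restricting to one side of a pair of the list itself only kills the leaves
    on the other side of that pair, so agreement is kept; this gives access to
    the pairs without tracking their positions. *)
Lemma agree_restrict p q s a b : agree p q s -> (a, b) \in s ->
  agree (p `&` a) (q `&` b) s /\ agree (p `&` ~` a) (q `&` ~` b) s.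
Proof.
elim: s p q => [//|[a0 b0] s IHs] p q /= /andP[h1 h2].
rewrite in_cons => /orP[/eqP[-> ->]|abs].
  by rewrite -!meetA !meetxx meetxC [~` a0 `&` a0]meetC [~` b0 `&` b0]meetC
     !meetxC !meetx0 !agree_bot h1 h2.
have [h11 h12] := IHs _ _ h1 abs; have [h21 h22] := IHs _ _ h2 abs.
by rewrite ![_ `&` a `&` _]meetAC ![_ `&` b `&` _]meetAC
   ![_ `&` ~` a `&` _]meetAC ![_ `&` ~` b `&` _]meetAC h11 h12 h21 h22.
Qed.

(** Restricting to [a `&` ~` a'] compares the vanishing of this meet with that of
    [b `&` ~` b'], and its vanishing is what [a <= a'] means. *)
Lemma agree_le s a b a' b' : agree \top \top s ->
  (a, b) \in s -> (a', b') \in s -> (a <= a') = (b <= b').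
Proof.
move=> sP /(agree_restrict sP)[+ _] a'b's; rewrite !meet1x.
case/agree_restrict/(_ a'b's) => _ /agree_eq0.
by rewrite !disj_leC !complK.
Qed.

(** Below [q], an element counts only through its trace on [q]; this is what
    makes the gluing in [agree_forth] legitimate. *)
Lemma agree_rcons_meet p q s a b b' : q `&` b = q `&` b' ->
  agree p q (rcons s (a, b)) = agree p q (rcons s (a, b')).
Proof.
elim: s p q => [|[a0 b0] s IHs] p q /= qb.
  suff -> : q `&` ~` b = q `&` ~` b' by rewrite qb.
  have meetC_meet (x y : B) : x `&` ~` y = x `&` ~` (x `&` y).
    by rewrite complI meetUr meetxC join0x.
  by rewrite meetC_meet qb -meetC_meet.
by congr (_ && _); apply: IHs; rewrite meetAC qb meetAC.
Qed.

(** If [a] cuts [p] trivially, so does [\bot] or [\top] on the other side; if it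
    cuts [p] properly, then [q] is nonzero and must be cut properly, which is
    where atomlessness enters. *)
Lemma split_cell p q a : atomless B -> (p == \bot) = (q == \bot) ->
  exists b, (p `&` a == \bot) = (q `&` b == \bot) /\
            (p `&` ~` a == \bot) = (q `&` ~` b == \bot).
Proof.
move=> atlB pq; have pE := meet_split_eq0 p a.
have [pa0|pa_n0] := boolP (p `&` a == \bot).
  exists \bot; rewrite meetx0 eqxx compl0 meetx1 -pq; split=> //.
  by rewrite pE pa0.
have [pa0|pCa_n0] := boolP (p `&` ~` a == \bot).
  exists \top; rewrite compl1 meetx0 eqxx meetx1 -pq; split=> //.
  by rewrite pE pa0 andbT (negbTE pa_n0).
have q_n0 : q != \bot by rewrite -pq pE negb_and pa_n0.
have [b [b_n0 ltbq]] : exists b, b != \bot /\ b < q.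
  apply: contrapT => no_b; apply: atlB; exists q; split; first exact/eqP.
  move=> b /eqP b_n0 lebq; apply/eqP/negPn/negP => bq.
  by apply: no_b; exists b; rewrite lt_neqAle bq.
exists b; rewrite (meet_r (ltW ltbq)) (negbTE b_n0) disj_leC complK.
by rewrite lt_geF.
Qed.

(** At a node [(a0, b0)] of the tree the images found in the two subtrees are
    glued along [b0]; each subtree sees only its own half. *)
Lemma agree_forth p q s a : atomless B -> agree p q s ->
  exists b, agree p q (rcons s (a, b)).
Proof.
move=> atlB; elim: s p q => [|[a0 b0] s IHs] p q /=.
  move/eqP/(split_cell a atlB) => [b [-> ->]]; exists b.
  by rewrite !eqxx.
case/andP=> /IHs[b1 h1] /IHs[b2 h2].
exists ((b0 `&` b1) `|` (~` b0 `&` b2)); apply/andP; split.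
  rewrite (@agree_rcons_meet _ _ _ _ _ b1) // meetUr !meetA.
  by rewrite -[q `&` b0 `&` b0]meetA -[q `&` b0 `&` ~` b0]meetA
     meetxx meetxC meetx0 meet0x joinx0.
rewrite (@agree_rcons_meet _ _ _ _ _ b2) // meetUr !meetA.
by rewrite -[q `&` ~` b0 `&` b0]meetA -[q `&` ~` b0 `&` ~` b0]meetA
   meetxx [~` b0 `&` b0]meetC meetxC meetx0 meet0x join0x.
Qed.

End Agree.

Lemma agree_swap (dA dB : Order.disp_t)
    (A : ctbDistrLatticeType dA) (B : ctbDistrLatticeType dB)
    (p : A) (q : B) (s : seq (A * B)) :
  agree q p [seq (x.2, x.1) | x <- s] = agree p q s.
Proof.
by elim: s p q => [|[a b] s IHs] p q /=; [rewrite eq_sym | rewrite !IHs].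
Qed.

Lemma agree_back (dA dB : Order.disp_t)
    (A : ctbDistrLatticeType dA) (B : ctbDistrLatticeType dB)
    (p : A) (q : B) (s : seq (A * B)) (b : B) :
  atomless A -> agree p q s -> exists a, agree p q (rcons s (a, b)).
Proof.
move=> atlA; rewrite -agree_swap => /(agree_forth b atlA)[a sP].
by exists a; rewrite -agree_swap map_rcons.
Qed.

(** * The back-and-forth construction *)

Lemma countable_enum (T : Type) (x0 : T) :
  countable [set: T]%classic -> exists e : nat -> T, forall x, exists n, e n = x.
Proof.
case/countable_injP => f f_inj.
have [e eP] : {e : nat -> T & forall n x, f x = n -> e n = x}.
  apply: (@choice _ _ (fun n y => forall x, f x = n -> y = x)) => n.
  have [[x fx]|nofx] := pselect (exists x, f x = n).
    by exists x => y fy; apply: f_inj; rewrite ?in_setT // fx.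
  by exists x0 => x fx; case: nofx; exists x.
by exists e => x; exists (f x); apply: eP.
Qed.

(** The only trace of the increasing chain of lists kept in the conclusion is
    that any two related pairs occur in a common admissible list, which is
    enough to compare them. *)
Lemma back_and_forth (A B : eqType) (a0 : A) (b0 : B) (P : seq (A * B) -> Prop) :
  countable [set: A]%classic -> countable [set: B]%classic ->
  P [::] ->
  (forall s a, P s -> exists b, P (rcons s (a, b))) ->
  (forall s b, P s -> exists a, P (rcons s (a, b))) ->
  exists R : A -> B -> Prop,
    [/\ forall a, exists b, R a b,
        forall b, exists a, R a b &
        forall a b a' b', R a b -> R a' b' ->
          exists s, [/\ P s, (a, b) \in s & (a', b') \in s]].
Proof.
move=> /(countable_enum a0)[eA eAP] /(countable_enum b0)[eB eBP] P0 forth back.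
have [step stepP] : {step : nat * {s | P s} -> {s | P s} &
    forall ns : nat * {s | P s}, let s' := sval (step ns) in
      [/\ {subset sval ns.2 <= s'}, exists b, (eA ns.1, b) \in s' &
          exists a, (a, eB ns.1) \in s']}.
  apply: (@choice _ _ (fun ns s' => [/\ {subset sval ns.2 <= sval s'},
    exists b, (eA ns.1, b) \in sval s' & exists a, (a, eB ns.1) \in sval s'])).
  move=> [n [s sP]] /=.
  have [b s1P] := forth s (eA n) sP; have [a s2P] := back _ (eB n) s1P.
  exists (exist _ _ s2P) => /=; split.
  - by move=> x xs; rewrite !mem_rcons !in_cons mem_rcons in_cons xs !orbT.
  - by exists b; rewrite mem_rcons in_cons mem_rcons mem_head orbT.
  - by exists a; rewrite mem_rcons mem_head.
pose S := fix S n := if n is m.+1 then step (m, S m) else exist _ _ P0.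
have S_sub m n : (m <= n)%N -> {subset sval (S m) <= sval (S n)}.
  elim: n => [|n IHn]; first by rewrite leqn0 => /eqP->.
  rewrite leq_eqVlt => /predU1P[->//|/IHn sub_mn] x /sub_mn xS.
  by have [+ _ _] := stepP (n, S n); apply.
exists (fun a b => exists n, (a, b) \in sval (S n)); split.
- move=> a; have [n <-] := eAP a; have [_ [b bP] _] := stepP (n, S n).
  by exists b, n.+1.
- move=> b; have [n <-] := eBP b; have [_ _ [a aP]] := stepP (n, S n).
  by exists a, n.+1.
- move=> a b a' b' [m abS] [n a'b'S]; exists (sval (S (maxn m n))).
  split; first exact: svalP.
    exact: S_sub (leq_maxl m n) _ abS.
  exact: S_sub (leq_maxr m n) _ a'b'S.
Qed.

Theorem theorem4p1 (dA dB : Order.disp_t)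
    (A : ctbDistrLatticeType dA) (B : ctbDistrLatticeType dB)
    (ntA : nontrivial A) (countA : countable [set: A]%classic)
    (atomlessA : atomless A)
    (ntB : nontrivial B) (countB : countable [set: B]%classic)
    (atomlessB : atomless B) :
  ba_isomorphic A B.
Proof.
(* The empty list has the single cell [\top], which is nonzero on both sides. *)
have agree0 : agree (\top : A) (\top : B) [::].
  by rewrite /= ![\top == _]eq_sym (introF eqP ntA) (introF eqP ntB).
have [R [Rl Rr R2]] := back_and_forth (\bot : A) (\bot : B) countA countB agree0
  (fun s a => @agree_forth _ _ _ _ _ _ s a atomlessB)
  (fun s b => @agree_back _ _ _ _ _ _ s b atomlessA).
have R_le a b a' b' : R a b -> R a' b' -> (a <= a') = (b <= b').
  by move=> ab a'b'; have [s [sP ? ?]] := R2 _ _ _ _ ab a'b'; apply: agree_le sP _ _.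
have [[f fR] [g gR]] := (choice Rl, choice Rr).
exists f; apply: order_iso_ba_isomorphism => [|x y]; last first.
  by rewrite (R_le _ _ _ _ (fR x) (fR y)).
(* Comparing two pairs with a common component, in both orders, gives equality
   of the other components, so [f] and [g] are mutually inverse. *)
exists g => x; apply/le_anti.
  by rewrite !(R_le _ _ _ _ (gR (f x)) (fR x), R_le _ _ _ _ (fR x) (gR (f x))) lexx.
by rewrite -!(R_le _ _ _ _ (fR (g x)) (gR x), R_le _ _ _ _ (gR x) (fR (g x))) lexx.
Qed.
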